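(* Let $(X,d)$ be a countably generated Lorentzian metric space, let $K\subset X$ be compact, and let $Q\subset\mathbb{R}$ be a dense set. A sequence of isocausal curves $\sigma_n:[a_n,b_n]\to K$ converges uniformly to an isocausal curve $\sigma:[a,b]\to K$ if and only if it converges to $\sigma$ pointwise on $Q$.
   Context: Let $X$ be a set and $d:X\times X\to[0,+\infty)$ a function. Notation: $x\ll y$ iff $d(x,y)>0$; $I^+(x)=\{y: x\ll y\}$, $I^-(x)=\{y: y\ll x\}$; for $A\subset X$, $I^\pm(A)=\bigcup_{p\in A}I^\pm(p)$ and $I(A)=I^+(A)\cap I^-(A)$; $I(p,q):=I(\{p,q\})$. For $\epsilon>0$, $I_\epsilon=\{(x,y): d(x,y)\ge\epsilon\}$. $(X,d)$ is a Lorentzian metric space if: (i) $d(x,z)\ge d(x,y)+d(y,z)$ whenever $d(x,y)>0$ and $d(y,z)>0$; (ii) there is a topology $T$ on $X$ such that $d$ is continuous in the product topology and, for every $x,y\in X$ and $\epsilon>0$, the set $I_\epsilon\cap(\overline{I(x,y)}\times\overline{I(x,y)})$ is compact; (iii) for all $x\ne y$ there is $z\in X$ with $d(x,z)\ne d(y,z)$ or $d(z,x)\ne d(z,y)$. It is countably generated if there is a countable $\mathscr{G}\subset X$ with $X=I(\mathscr{G})$; then the topology in (ii) is unique (and Polish) and $X$ is endowed with it. Causal relation: $x\le y$ means $d(p,y)\ge d(p,x)$ and $d(x,p)\ge d(y,p)$ for all $p\in X$; $x<y$ means $x\le y$ and $x\ne y$. A continuous curve $\sigma:[a,b]\to X$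 is isocausal if $a\le s<t\le b$ implies $\sigma(s)<\sigma(t)$. For a curve $\sigma:[a,b]\to X$, $\hat\sigma:\mathbb{R}\to X$ is the extension equal to $\sigma(a)$ for $s<a$, $\sigma(s)$ for $s\in[a,b]$, and $\sigma(b)$ for $s>b$. $\sigma_n:[a_n,b_n]\to X$ converges uniformly to $\sigma:[a,b]\to X$ if $a_n\to a$, $b_n\to b$ and $\hat\sigma_n\to\hat\sigma$ uniformly on $\mathbb{R}$ (for curves in a compact set $K$, with respect to the unique uniformity on $K$ compatible with its topology). It converges pointwise on $Q$ if $a_n\to a$, $b_n\to b$ and $\hat\sigma_n(s)\to\hat\sigma(s)$ for every $s\in Q$. *)

(* Defs.v *)
From HB Require Import structures.
From mathcomp Require Import all_boot all_order all_algebra.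
From mathcomp Require Import all_classical all_reals all_analysis.
Import Order.TTheory GRing.Theory Num.Theory.
Import numFieldNormedType.Exports.
Set Implicit Arguments.
Unset Strict Implicit.
Unset Printing Implicit Defensive.
Local Open Scope classical_set_scope.
Local Open Scope ring_scope.

Section Lorentzian.
Context {R : realType} {X : topologicalType}.
Variable d : X -> X -> R.

Definition chronological (x y : X) : Prop := 0 < d x y.

Definition chron_future (x : X) : set X := [set y | chronological x y].
Definition chron_past (x : X) : set X := [set y | chronological y x].

Definition chron_future_set (A : set X) : set X := \bigcup_(p in A) chron_future p.
Definition chron_past_set (A : set X) : set X := \bigcup_(p in A) chron_past p.
Definition chron_hull (A : set X) : set X := chron_future_set A `&` chron_past_set A.
Definition chron_diamond (p q : X) : set X := chron_hull [set p; q].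

Definition distance_ge (e : R) : set (X * X) := [set z | e <= d z.1 z.2].

(* The topology of [X] is itself the one required to exist by the definition of
   a Lorentzian metric space: it is unique in the countably generated case, and
   [X] is then endowed with it. *)
Record lorentzian_metric_space : Prop := LorentzianMetricSpace {
  distance_ge0 : forall x y, 0 <= d x y;
  reverse_triangle : forall x y z,
    0 < d x y -> 0 < d y z -> d x y + d y z <= d x z;
  distance_continuous : continuous (fun z : X * X => d z.1 z.2);
  distance_ge_compact : forall (x y : X) (e : R), 0 < e ->
    compact (distance_ge e `&`
      (closure (chron_diamond x y) `*` closure (chron_diamond x y)));
  distance_separates : forall x y, x <> y ->
    exists z, d x z <> d y z \/ d z x <> d z y
}.

Definition countably_generated : Prop :=
  exists2 G : set X, countable G & [set: X] = chron_hull G.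

Definition causal_le (x y : X) : Prop :=
  forall p, d p x <= d p y /\ d y p <= d x p.

Definition causal_lt (x y : X) : Prop := causal_le x y /\ x <> y.

(* A curve on [a, b] is a total function of which only the restriction to
   [a, b] matters; the degenerate interval a = b is allowed. *)
Definition isocausal (a b : R) (sigma : R -> X) : Prop :=
  [/\ a <= b,
      {within `[a, b], continuous sigma} &
      forall s t, a <= s -> s < t -> t <= b -> causal_lt (sigma s) (sigma t)].

End Lorentzian.

Definition curve_extension {R : realType} {T : Type} (a b : R) (sigma : R -> T) :
    R -> T :=
  fun s => if s < a then sigma a else if s <= b then sigma s else sigma b.

(* The axioms of [uniformType], for a set of entourages on a given topological
   space. *)
Record compatible_uniformity {T : topologicalType} (E : set_system (T * T)) :
    Prop := CompatibleUniformity {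
  compatible_filter : Filter E;
  compatible_diagonal : forall A, E A -> (diagonal `<=` A)%classic;
  compatible_inv : forall A, E A -> E (A^-1)%relation;
  compatible_split : forall A, E A ->
    exists2 B, E B & (B \; B `<=` A)%relation;
  compatible_nbhs : @nbhs T T = nbhs_ E
}.

(* On a compact Hausdorff space there is exactly one compatible uniformity, so
   the default value [set0] is not reached there. *)
Definition the_uniformity (T : topologicalType) : set_system (T * T) :=
  xget set0 [set E : set_system (T * T) | compatible_uniformity E].

Arguments the_uniformity T : clear implicits.

Definition curves_cvg_uniformly {R : realType} {T : topologicalType}
    (a_ b_ : nat -> R) (sigma_ : nat -> R -> T)
    (a b : R) (sigma : R -> T) : Prop :=
  [/\ a_ n @[n --> \oo] --> a,
      b_ n @[n --> \oo] --> b &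
      forall V, the_uniformity T V -> \forall n \near \oo, forall s,
        V (curve_extension a b sigma s, curve_extension (a_ n) (b_ n) (sigma_ n) s)].

Definition curves_cvg_pointwise {R : realType} {T : topologicalType} (Q : set R)
    (a_ b_ : nat -> R) (sigma_ : nat -> R -> T)
    (a b : R) (sigma : R -> T) : Prop :=
  [/\ a_ n @[n --> \oo] --> a,
      b_ n @[n --> \oo] --> b &
      forall s, Q s ->
        curve_extension (a_ n) (b_ n) (sigma_ n) s @[n --> \oo]
          --> curve_extension a b sigma s].

(* Main.v *)
(* For each [p] the functions [d p] and [- d _ p] are monotone for the causal
   relation. Composed with isocausal curves they give nondecreasing real
   functions, for which convergence on a dense set to a continuous limit is
   locally uniform. The functions [d p] and [- d _ p] separate the points of the
   compact set [K], so the curves themselves converge locally uniformly, hence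
   uniformly on a compact interval outside which all the extended curves are
   eventually constant. *)
Require Import Defs.
From HB Require Import structures.
From mathcomp Require Import all_boot all_order all_algebra.
From mathcomp Require Import all_classical all_reals all_analysis.
From mathcomp Require Import lra.
Import Order.TTheory GRing.Theory Num.Theory.
Import numFieldNormedType.Exports.
Local Open Scope classical_set_scope.
Local Open Scope ring_scope.

Set Implicit Arguments.
Unset Strict Implicit.
Unset Printing Implicit Defensive.

(** * Convergence tested by separating functions and by monotonicity *)

Lemma cluster_cvg_eq {T U : topologicalType} (f : T -> U) (F : set_system T)
    (y : T) (l : U) :
  hausdorff_space U -> {for y, continuous f} -> cluster F y -> f @ F --> l ->
  f y = l.
Proof.
move=> hU cf Fy fFl; apply/esym/hU; apply: (cvg_cluster fFl) => A B FA By.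
by have [z [Az Bz]] := Fy _ _ FA (cf _ By); exists (f z).
Qed.

Section SeparatingFunctions.
Context {R : realType} {T : topologicalType} (U : set (T -> R)).
Hypothesis U_continuous : forall u, U u -> continuous u.
Hypothesis U_separates : forall x y, (forall u, U u -> u x = u y) -> x = y.

Lemma separating_hausdorff : hausdorff_space T.
Proof.
move=> x y xy; apply: U_separates => u Uu; apply/esym.
by apply: (cluster_cvg_eq (@Rhausdorff R) _ xy); exact: U_continuous.
Qed.

(** At a cluster point [y] of [F], every [u] in [U] takes the value [u x], so separation leaves [x]
    as the only cluster point. In a compact Hausdorff space a filter with a single cluster point
    converges to it. *)
Lemma compact_separating_cvg (F : set_system T) (x : T) :
  compact [set: T] -> ProperFilter F ->
  (forall u, U u -> u @ F --> u x) -> F --> x.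
Proof.
move=> cT PF uF; apply: (compact_cluster_set1 separating_hausdorff cT) => //.
- exact: filterT.
- exact: filterT.
have eqx y : cluster F y -> y = x.
  move=> Fy; apply: U_separates => u Uu.
  apply: (cluster_cvg_eq (@Rhausdorff R) _ Fy (uF u Uu)).
  exact: U_continuous.
apply/seteqP; split => [y /eqx //|_ ->].
by have [y [_ Fy]] := cT F PF filterT; rewrite -(eqx y Fy).
Qed.

End SeparatingFunctions.

Lemma compact_set_type {X : topologicalType} (K : set X) :
  compact K -> compact [set: K].
Proof.
move=> cK F PF _.
have [|x [Kx Fx]] := cK ((set_val : K -> X) @ F) (fmap_proper_filter _ PF).
  by apply: (@filterE _ F) => z; exact: set_valP.
exists (SigSub (mem_set Kx)); split => // A B FA [_ [[W oW <-] Wx WB]].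
have valA : ((set_val : K -> X) @ F) (set_val @` A).
  by apply: (@filterS _ F _ A) FA => z Az; exists z.
have [_ [[z Az <-] Wz]] := Fx _ W valA (open_nbhs_nbhs (conj oW Wx)).
by exists z; split => //; exact: WB.
Qed.

Lemma set_val_continuous {X : topologicalType} (K : set X) :
  continuous (set_val : K -> X).
Proof. exact: (@initial_continuous K X set_val). Qed.

(** A compact Hausdorff space is normal, hence completely regular, hence uniformizable. Exhibiting
    one compatible uniformity ensures that [xget] does not return its default [set0]. *)
Lemma the_uniformity_compatible {R : realType} {T : topologicalType} :
  compact [set: T] -> hausdorff_space T ->
  compatible_uniformity (the_uniformity T).
Proof.
move=> cT hT.
have crs : completely_regular_space T.
  apply: (@normal_completely_regular R); first exact: compact_normal.
  exact: hausdorff_accessible.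
apply: (@xgetPex _ set0 (fun E => compatible_uniformity E)).
pose T' := @completely_regular_uniformity.type R T crs.
exists (@entourage T'); split.
- exact: (@entourage_filter T').
- exact: (@entourage_diagonal_subproof T').
- exact: (@entourage_inv T').
- exact: (@entourage_split_ex T').
- exact: (@nbhsE_subproof T').
Qed.

(** A squeeze: pick [q < s < p] in [Q] close to [s]. Monotonicity traps [f_ n t] between [f_ n q]
    and [f_ n p] for all [t] in []q, p[] at once. The product filter on the pairs [(n, t)] expresses
    that the convergence is locally uniform. *)
Lemma nondecreasing_dense_cvg {R : realType} (Q : set R)
    (f_ : nat -> R -> R) (f : R -> R) (s : R) :
  dense Q -> (forall n, {homo f_ n : x y / x <= y}) ->
  {for s, continuous f} ->
  (forall q, Q q -> f_ n q @[n --> \oo] --> f q) ->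
  (fun z : nat * R => f_ z.1 z.2) @ filter_prod \oo (nbhs s) --> f s.
Proof.
move=> dQ f_nd fs fQ; apply/cvgrPdist_lt => e e0.
(* One half of [e] pays for the continuity of [f] at [s], the other for the convergence at [q] and
   [p]. *)
have /cvgrPdist_lt/(_ (e / 2)) := fs.
rewrite divr_gt0// => /(_ isT)/nbhs_ballP[r /= r0 fr].
have Q_itv (x y : R) : x < y -> exists2 q, Q q & x < q < y.
  move=> xy; have [|q [/= xqy Qq]] := dQ `]x, y[%classic _ (itv_open _ _).
    by exists ((x + y) / 2) => /=; rewrite in_itv/=; apply/andP; split; lra.
  by exists q => //; move: xqy; rewrite in_itv.
have [q Qq /andP[srq qs]] : exists2 q, Q q & s - r < q < s by apply: Q_itv; lra.
have [p Qp /andP[sp psr]] : exists2 q, Q q & s < q < s + r by apply: Q_itv; lra.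
have /fr/= fq : ball s r q by rewrite /ball/= ltr_norml; lra.
have /fr/= fp : ball s r p by rewrite /ball/= ltr_norml; lra.
have e20 : 0 < e / 2 by rewrite divr_gt0.
have /cvgrPdist_lt/(_ _ e20) fnq := fQ q Qq.
have /cvgrPdist_lt/(_ _ e20) fnp := fQ p Qp.
exists ([set n | `|f q - f_ n q| < e / 2] `&` [set n | `|f p - f_ n p| < e / 2],
        `]q, p[%classic); first split.
- exact: filterI.
- by apply: near_in_itvoo; rewrite in_itv/= qs sp.
move=> [n t] /= [[nq np]]; rewrite in_itv/= => /andP[/ltW qt /ltW tp].
have := f_nd n _ _ qt; have := f_nd n _ _ tp.
move: fq fp nq np; rewrite !ltr_norml; lra.
Qed.

(** * Extended curves as curves composed with a clamp *)

Section CurveExtension.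
Context {R : realType}.

Lemma curve_extension_clamp {T : Type} (a b : R) (sigma : R -> T) (s : R) :
  a <= b ->
  curve_extension a b sigma s = sigma (Num.max a (Num.min s b)).
Proof.
move=> ab; rewrite /curve_extension; case: ltP => [sa|as_].
  by rewrite min_l ?max_l// ltW// (lt_le_trans sa).
by case: leP => [sb|bs]; rewrite max_r.
Qed.

Lemma clamp_bounds (a b s : R) :
  a <= b -> a <= Num.max a (Num.min s b) <= b.
Proof. by move=> ab; rewrite le_max lexx ge_max ab ge_min lexx orbT. Qed.

(** Used to bring an arbitrary parameter into a fixed interval containing all the [[a_n, b_n]] with
    [n] large, without changing the extended curves. *)
Lemma clamp_clamp (a b c e s : R) : a <= c -> c <= e -> e <= b ->
  Num.max c (Num.min (Num.max a (Num.min s b)) e) = Num.max c (Num.min s e).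
Proof.
move=> ac ce eb; have [se|es] := leP s e.
  rewrite [Num.min s b]min_l ?(le_trans se)// min_l.
    by rewrite maxA (max_l ac).
  by rewrite ge_max se (le_trans ac ce).
by rewrite min_r// le_max le_min (ltW es) eb orbT.
Qed.

Lemma curve_extension_comp {T U : Type} (f : T -> U) (a b : R)
    (sigma : R -> T) (s : R) :
  curve_extension a b (f \o sigma) s = f (curve_extension a b sigma s).
Proof. by rewrite /curve_extension; case: ifP => // _; case: ifP. Qed.

Lemma curve_extension_continuous {T : topologicalType} (a b : R)
    (sigma : R -> T) :
  a <= b -> {within `[a, b], continuous sigma} ->
  continuous (curve_extension a b sigma).
Proof.
move=> ab /subspace_sigL_continuousP csigma.
have clampP s : (Num.max a (Num.min s b)) \in `[a, b]%classic.
  by apply/mem_set; rewrite /= in_itv/= clamp_bounds.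
(* With values in the subtype, the clamp turns continuity within [[a, b]] into ordinary continuity
   of a composite. *)
pose clamp s : `[a, b]%classic := SigSub (clampP s).
have cclamp : continuous clamp.
  apply: (@continuous_comp_initial _ _ _ set_val) => s.
  apply: (@continuous_max _ _ (cst a) (fun s => Num.min s b)).
    exact: cvg_cst.
  by apply: (@continuous_min _ _ id (cst b)); [exact: cvg_id|exact: cvg_cst].
have -> : curve_extension a b sigma = sigL `[a, b] sigma \o clamp.
  by apply/funext => s; rewrite curve_extension_clamp.
by move=> s; apply: continuous_comp; [exact: cclamp|exact: csigma].
Qed.

End CurveExtension.

(** * Causal monotonicity and the distance functions *)

Section CausalRelation.
Context {R : realType} {X : topologicalType} (d : X -> X -> R).

Lemma causal_le_refl x : causal_le d x x.
Proof. by move=> p; split. Qed.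

(** Clamping is nondecreasing but not injective, so only the reflexive relation survives outside
    [[a, b]]. *)
Lemma isocausal_extension_homo (a b : R) (sigma : R -> X) :
  isocausal d a b sigma -> forall s t, s <= t ->
  causal_le d (curve_extension a b sigma s) (curve_extension a b sigma t).
Proof.
move=> [ab _ sigma_lt] s t st; rewrite !curve_extension_clamp//.
have /andP[as_ sb] := clamp_bounds s ab; have /andP[at_ tb] := clamp_bounds t ab.
have : Num.max a (Num.min s b) <= Num.max a (Num.min t b).
  by rewrite ge_max !le_max lexx/= le_min !ge_min st lexx !orbT.
rewrite le_eqVlt => /predU1P[->|/sigma_lt]; first exact: causal_le_refl.
by move=> /(_ as_ tb)[].
Qed.

End CausalRelation.

Section DistanceFunctions.
Context {R : realType} {X : topologicalType} (d : X -> X -> R).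
Hypothesis hd : lorentzian_metric_space d.

Definition distance_functions (K : set X) : set (K -> R) :=
  [set u | exists p, u = d p \o set_val \/ u = d^~ p \o set_val].

Lemma distance_functions_continuous (K : set X) (u : K -> R) :
  distance_functions u -> continuous u.
Proof.
have cd := distance_continuous hd.
move=> [p [->|->]] x; apply: continuous_comp;
  try exact: set_val_continuous; set y := set_val x.
- apply: (@continuous_comp _ _ _ (fun y => (p, y)) (fun z => d z.1 z.2)).
    by apply: cvg_pair; [exact: cvg_cst|exact: cvg_id].
  exact: cd.
- apply: (@continuous_comp _ _ _ (fun y => (y, p)) (fun z => d z.1 z.2)).
    by apply: cvg_pair; [exact: cvg_id|exact: cvg_cst].
  exact: cd.
Qed.

Lemma distance_functions_separate (K : set X) (x y : K) :
  (forall u, distance_functions u -> u x = u y) -> x = y.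
Proof.
move=> xy; apply: val_inj; apply: contrapT.
move=> /(distance_separates hd)[z [|]]; apply.
- by apply: (xy (d^~ z \o set_val)); exists z; right.
- by apply: (xy (d z \o set_val)); exists z; left.
Qed.

Lemma isocausal_joint_cvg (K : set X) (Q : set R)
    (a_ b_ : nat -> R) (sigma_ : nat -> R -> K)
    (a b : R) (sigma : R -> K) (s : R) :
  compact K -> dense Q ->
  (forall n, isocausal d (a_ n) (b_ n) (set_val \o sigma_ n)) ->
  continuous (curve_extension a b sigma) ->
  (forall q, Q q -> curve_extension (a_ n) (b_ n) (set_val \o sigma_ n) q
     @[n --> \oo] --> curve_extension a b (set_val \o sigma) q) ->
  (fun z : nat * R => curve_extension (a_ z.1) (b_ z.1) (sigma_ z.1) z.2)
    @ filter_prod \oo (nbhs s) --> curve_extension a b sigma s.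
Proof.
move=> cK dQ iso csigma cvgQ.
pose g n t := curve_extension (a_ n) (b_ n) (sigma_ n) t.
pose g0 t := curve_extension a b sigma t.
have g_le n x y : x <= y -> causal_le d (set_val (g n x)) (set_val (g n y)).
  by move=> xy; rewrite -!(curve_extension_comp set_val); exact: isocausal_extension_homo.
have dcvg u q : distance_functions u -> Q q ->
    u (g n q) @[n --> \oo] --> u (g0 q).
  move=> du Qq.
  have gq : g n q @[n --> \oo] --> g0 q.
    (* Neighbourhoods in [K] are traces of neighbourhoods in [X], so the convergence in [X] lifts to
       [K]. *)
    move=> B [_ [[W oW <-] Wq WB]].
    have /cvgQ := Qq; rewrite curve_extension_comp.
    move=> /(_ W (open_nbhs_nbhs (conj oW Wq))); apply: (@filterS _ \oo) => n /=.
    by rewrite curve_extension_comp; exact: WB.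
  have uq := distance_functions_continuous du (x := g0 q).
  exact: (cvg_comp _ _ gq uq).
apply: (compact_separating_cvg (U := @distance_functions K)).
- exact: distance_functions_continuous.
- exact: distance_functions_separate.
- exact: compact_set_type.
move=> u du.
have ug0 : {for s, continuous (u \o g0)}.
  apply: continuous_comp; first exact: csigma.
  by move: (g0 s); exact: distance_functions_continuous.
have [p [up|up]] := du; rewrite -/(g0 s).
- apply: (@nondecreasing_dense_cvg _ Q (fun n => u \o g n) (u \o g0)) => //.
    by move=> n x y /(g_le n)/(_ p)[+ _]; rewrite up.
  by move=> q Qq; exact: (dcvg _ _ du Qq).
(* [d^~ p] decreases along the causal relation, so the squeeze is applied to its opposite. *)
- apply/cvgNP.
  apply: (@nondecreasing_dense_cvg _ Q (fun n => - (u \o g n)) (- (u \o g0))) => //.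
  + by move=> n x y /(g_le n)/(_ p)[_]; rewrite up /= lerN2.
  + exact: cvgN.
  + by move=> q Qq; apply: cvgN; exact: (dcvg _ _ du Qq).
Qed.

End DistanceFunctions.

Theorem corollary5p8 (R : realType) (X : topologicalType) (d : X -> X -> R)
    (hd : lorentzian_metric_space d) (hG : countably_generated d)
    (K : set X) (hK : compact K) (Q : set R) (hQ : dense Q)
    (a_ b_ : nat -> R) (sigma_ : nat -> R -> K)
    (hsigma_ : forall n, isocausal d (a_ n) (b_ n) (fun s => set_val (sigma_ n s)))
    (a b : R) (sigma : R -> K)
    (hsigma : isocausal d a b (fun s => set_val (sigma s))) :
  curves_cvg_uniformly a_ b_ sigma_ a b sigma <->
  curves_cvg_pointwise Q a_ b_ (fun n s => set_val (sigma_ n s))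
    a b (fun s => set_val (sigma s)).
Proof.
have cKT := compact_set_type hK.
have hKT : hausdorff_space K := separating_hausdorff
  (distance_functions_continuous hd (K:=K)) (distance_functions_separate hd (K:=K)).
have [FE Ediag Einv Esplit nbhsE] := @the_uniformity_compatible R K cKT hKT.
have csigma : continuous (curve_extension a b sigma).
  have [ab cs _] := hsigma; apply: (@continuous_comp_initial _ _ _ set_val).
  have -> : set_val \o curve_extension a b sigma =
      curve_extension a b (set_val \o sigma).
    by apply/funext => s; rewrite curve_extension_comp.
  exact: curve_extension_continuous.
split => [[a_cvg b_cvg Ecvg]|[a_cvg b_cvg Qcvg]]; split => //.
  (* Sections of entourages are the neighbourhoods in [K], so uniform convergence gives convergence
     at each [s]. *)
  move=> s _; rewrite (curve_extension_comp set_val).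
  under eq_fun do rewrite (curve_extension_comp set_val).
  apply: (@cvg_comp _ _ _ _ set_val); last exact: set_val_continuous.
  move=> B; rewrite nbhsE => -[V EV VB].
  by apply: filterS (Ecvg V EV) => n Vn; apply: VB; apply/mem_set; exact: Vn.
(* For [t] near [s] and [n] large, the points at [t] of the limit and of the [n]-th curve are
   compared through [x], the limit at [s]: one leg by continuity, the other by joint convergence,
   each in [W]. *)
move=> V EV; have [W EW WV] := Esplit V EV.
have loc s : [set` `[a - 1, b + 1]] s -> \forall t \near s & n \near \oo,
    V (curve_extension a b sigma t, curve_extension (a_ n) (b_ n) (sigma_ n) t).
  move=> _.
  have joint := isocausal_joint_cvg hd (s := s) hK hQ hsigma_ csigma Qcvg.
  set x := curve_extension a b sigma s in joint.
  have /joint[[N S] /= [oN sS] NS] : nbhs x (xsection W x) by rewrite nbhsE; exists W.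
  (* The inverse appears because the first leg runs from the point at [t] to [x]. *)
  have Wx : nbhs x (xsection (W^-1)%relation x).
    by rewrite nbhsE; exists (W^-1)%relation => //; exact: Einv.
  exists (S `&` curve_extension a b sigma @^-1` (xsection (W^-1)%relation x), N) => /=.
    by split => //; apply: filterI => //; exact: csigma Wx.
  move=> [t n] /= [[St /set_mem Wt] Nn]; apply: WV; exists x => //=.
  by have /set_mem := NS (n, t) (conj Nn St).
(* Compactness of the segment makes the threshold on [n] independent of [t]. The margin 1 leaves
   room for [a_n] and [b_n] to lie inside eventually. *)
have /compact_near_coveringP := @segment_compact R (a - 1) (b + 1).
move=> /(_ _ \oo _ _ loc) unif.
have [ab _ _] := hsigma.
near=> n => s.
have aan : a - 1 < a_ n by near: n; apply: (cvgr_gt a) => //; lra.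
have bbn : b_ n < b + 1 by near: n; apply: (cvgr_lt b) => //; lra.
have [abn _ _] := hsigma_ n.
have Vn : forall t, [set` `[a - 1, b + 1]] t ->
    V (curve_extension a b sigma t, curve_extension (a_ n) (b_ n) (sigma_ n) t).
  by near: n.
(* Both extended curves take the same values at [s] and at its clamp [t], so the bound on the
   segment covers the whole line. *)
pose t := Num.max (a - 1) (Num.min s (b + 1)).
have tab : [set` `[a - 1, b + 1]] t by rewrite /= in_itv/= clamp_bounds//; lra.
have := Vn t tab; rewrite !curve_extension_clamp// !clamp_clamp//; lra.
Unshelve. all: by end_near. Qed.
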